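(* The Horn form $$F = \left(\sum_{i=1}^5 X_i^2\right)^2 - 4\sum_{i=1}^5 X_i^2X_{i+1}^2$$ in the five variables $X_1,\dots,X_5$, where subscripts are taken cyclically modulo $5$ (so $X_6=X_1$), is stubborn.
   Context: A real form is nonnegative if it takes only nonnegative values on $\mathbb{R}^n$. A form of degree $d$ is a sum of squares if it equals $H_1^2+\dots+H_r^2$ for some real forms $H_i$ of degree $d/2$. A nonnegative form $P$ is stubborn if $P^k$ is not a sum of squares for any odd $k\ge 1$. *)

(* Defs.v *)
From mathcomp Require Import all_boot all_order all_algebra.
From mathcomp Require Import reals.
From mathcomp Require Import mpoly.

Set Implicit Arguments.
Unset Strict Implicit.
Unset Printing Implicit Defensive.

Import Order.TTheory GRing.Theory Num.Theory.

Local Open Scope ring_scope.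

Definition nonnegative (R : realType) (n : nat) (P : {mpoly R[n]}) : Prop :=
  forall x : 'I_n -> R, 0 <= P.@[x].

(* A form of degree [d] is a polynomial that is [d.-homog]; this includes the
   zero polynomial. The equation [d = e.*2] makes [e] exactly half of [d]. *)
Definition sum_of_squares (R : realType) (n d : nat) (P : {mpoly R[n]}) : Prop :=
  exists (e r : nat) (H : 'I_r -> {mpoly R[n]}),
    [/\ d = e.*2, forall i, H i \is e.-homog & P = \sum_(i < r) H i ^+ 2].

(* If [P] is a form of degree [d] then [P ^+ k] is a form of degree [d * k]. An
   odd [k] is automatically at least 1. *)
Definition stubborn (R : realType) (n d : nat) (P : {mpoly R[n]}) : Prop :=
  [/\ P \is d.-homog, nonnegative P &
      forall k : nat, odd k -> ~ sum_of_squares (d * k) (P ^+ k)].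

(* The variables are indexed from 0 to 4, and [ordS] is the cyclic successor
   on ['I_5]. *)
Definition horn_form (R : realType) : {mpoly R[5]} :=
  (\sum_(i < 5) 'X_i ^+ 2) ^+ 2 - 4 *: \sum_(i < 5) 'X_i ^+ 2 * 'X_(ordS i) ^+ 2.

(* Main.v *)
Require Import Defs.
From mathcomp Require Import all_boot all_order all_algebra.
From mathcomp Require Import reals.
From mathcomp Require Import mpoly.
From mathcomp Require Import ring zify.

Set Implicit Arguments.
Unset Strict Implicit.
Unset Printing Implicit Defensive.

Import Order.TTheory GRing.Theory Num.Theory.

Local Open Scope ring_scope.

(** The form is nonnegative because, as a quadratic form in the squares
    [y_i = X_i^2], it is copositive: it can be written as the square of an
    alternating sum plus nonnegative products, in one of two ways according to
    which of two adjacent [y_i] is larger ([horn_form_copositive]).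

    No odd power is a sum of squares, because of an obstruction going round the
    5-cycle of the variables.  On the coordinate plane of two adjacent variables
    [X_j, X_(j+1)] the form restricts to the perfect square
    [(X_j^2 - X_(j+1)^2)^2].  Thus if [F^k = \sum_i H_i^2], then on that plane
    every [H_i] is a constant multiple of [(X_j^2 - X_(j+1)^2)^k].  For odd [k]
    that power takes opposite values on the two axes, so
    [H_i(2 e_(j+1)) = - H_i(2 e_j)] ([sos_odd_pow_axes_opp]).  Five such sign
    changes lead back to [e_j]; as 5 is odd, [H_i(2 e_j) = 0] for all [i], whereas
    [F(2 e_j) = 16].

    The plane is only needed along the line [X_j = 1 + t, X_(j+1) = 1 - t], which
    meets the two axes at [t = 1] and [t = -1] and on which [F = 16 t^2].  The
    claim on the [H_i] then becomes a one-variable fact: if a sum of squares of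
    real polynomials is a monomial [c t^(2k)], each of them is a multiple of
    [t^k] ([sum_sqr_monomial]). *)

Lemma sumr_sqr_eq0 (R : realDomainType) (r : nat) (a : 'I_r -> R) :
  \sum_(i < r) a i ^+ 2 = 0 -> forall i, a i = 0.
Proof.
move=> a0 i; apply/eqP; rewrite -sqrf_eq0; apply/eqP.
by apply: (psumr_eq0P _ a0) => // j _; exact: sqr_ge0.
Qed.

(** At the top or bottom degree [m] of [p], the products [p_i p_j] with
    [i + j = 2m] all have a vanishing factor except for [i = j = m].  One
    statement covers both ends, since [i] and [j] lie on opposite sides of [m]. *)
Lemma coef_sqr_extremal (R : comNzRingType) (p : {poly R}) (m : nat) :
  (forall j, (m < j)%N -> p`_j = 0) \/ (forall j, (j < m)%N -> p`_j = 0) ->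
  (p ^+ 2)`_m.*2 = p`_m ^+ 2.
Proof.
move=> p0; have mlt : (m < m.*2.+1)%N by lia.
rewrite expr2 coefM (bigD1 (Ordinal mlt)) //= big1 ?addr0.
  by rewrite [in LHS](_ : (m.*2 - m)%N = m) ?expr2 //; lia.
move=> [i ilt]; rewrite -val_eqE /= => im.
have [mi|mi] : (m < i /\ m.*2 - i < m \/ i < m /\ m < m.*2 - i)%N by lia.
- by case: p0 => p0;
    [rewrite p0 ?mul0r | rewrite [X in _ * X]p0 ?mulr0] => //; lia.
- by case: p0 => p0;
    [rewrite [X in _ * X]p0 ?mulr0 | rewrite p0 ?mul0r] => //; lia.
Qed.

(** The extreme coefficients of a sum of real squares cannot cancel, being sums
    of squares themselves: coefficients of the [p i] of degree other than [k] are
    eliminated from the bottom up and from the top down. *)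
Lemma sum_sqr_monomial (R : realDomainType) (r k : nat) (c : R)
    (p : 'I_r -> {poly R}) :
  \sum_(i < r) p i ^+ 2 = c *: 'X^(k.*2) ->
  forall i, p i = (p i)`_k *: 'X^k.
Proof.
move=> sump.
have coef0 j : j != k ->
    (forall i, (p i ^+ 2)`_j.*2 = (p i)`_j ^+ 2) -> forall i, (p i)`_j = 0.
  move=> jk sqrj; apply: sumr_sqr_eq0.
  under eq_bigr do rewrite -sqrj.
  rewrite -coef_sum sump coefZ coefXn (_ : (j.*2 == k.*2) = false) ?mulr0 //.
  by lia.
have low j : (j < k)%N -> forall i, (p i)`_j = 0.
  elim/ltn_ind: j => j IHj jk; apply: coef0; first by lia.
  by move=> i; apply: coef_sqr_extremal; right=> l lj; apply: IHj; lia.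
(* Downward induction on the degree, started above all the sizes. *)
have high n j : (k < j)%N -> (\max_(i < r) size (p i) <= j + n)%N ->
    forall i, (p i)`_j = 0.
  elim: n j => [|n IHn] j kj maxj.
    move=> i; apply: nth_default; rewrite addn0 in maxj.
    by apply: leq_trans maxj; exact: (leq_bigmax (F := fun i => size (p i))).
  apply: coef0; first by lia.
  by move=> i; apply: coef_sqr_extremal; left=> l jl; apply: IHn; lia.
move=> i; apply/polyP => j; rewrite coefZ coefXn.
case: (ltngtP j k) => [jk|kj|->]; rewrite ?mulr1 ?mulr0 //; first exact: low.
exact: (high _ _ kj (leq_addl _ _)).
Qed.

Lemma horner_mmap (R : comNzRingType) (n : nat) (v : 'I_n -> {poly R})
    (P : {mpoly R[n]}) (t : R) :
  (mmap polyC v P).[t] = P.@[fun i => (v i).[t]].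
Proof.
rewrite mevalE /mmap horner_sum; apply: eq_bigr => m _.
rewrite hornerM hornerC /mmap1 horner_prod; congr (_ * _).
by apply: eq_bigr => i _; rewrite horner_exp.
Qed.

(** Serves both for evaluation at a point ([S = R]) and for restriction to a
    line ([S = {poly R}]). *)
Lemma mmap_horn_form (R : realType) (S : comNzRingType) (f : {rmorphism R -> S})
    (v : 'I_5 -> S) :
  mmap f v (horn_form R) =
  (\sum_(i < 5) v i ^+ 2) ^+ 2 - 4 * \sum_(i < 5) v i ^+ 2 * v (ordS i) ^+ 2.
Proof.
rewrite /horn_form mmapB mmapZ !rmorphXn.
rewrite !rmorph_sum /=; congr (_ ^+ 2 - _ * _).
- by apply: eq_bigr => i _; rewrite rmorphXn /= mmapX mmap1U.
- by rewrite rmorph_nat.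
- by apply: eq_bigr => i _; rewrite rmorphM !rmorphXn /= !mmapX !mmap1U.
Qed.

(** The two identities below are exchanged by the reflection of the 5-cycle that
    swaps [d] and [e]; each serves when its last product is nonnegative. *)
Lemma horn_form_copositive (R : realDomainType) (a b c d e : R) :
  0 <= a -> 0 <= b -> 0 <= c -> 0 <= d -> 0 <= e ->
  4 * (a * b + b * c + c * d + d * e + e * a) <= (a + b + c + d + e) ^+ 2.
Proof.
move=> a0 b0 c0 d0 e0; rewrite -subr_ge0.
have [de|/ltW ed] := leP d e.
- rewrite (_ : _ - _ = (a - b + c + d - e) ^+ 2 + 4 * (b * d)
                       + 4 * (c * (e - d))); last by ring.
  by rewrite !addr_ge0 ?sqr_ge0 ?mulr_ge0 ?subr_ge0.
- rewrite (_ : _ - _ = (a - b + c - d + e) ^+ 2 + 4 * (b * e)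
                       + 4 * (a * (d - e))); last by ring.
  by rewrite !addr_ge0 ?sqr_ge0 ?mulr_ge0 ?subr_ge0.
Qed.

Lemma horn_form_nonneg (R : realType) : nonnegative (horn_form R).
Proof.
move=> x; rewrite /meval mmap_horn_form.
pose y (i : nat) := x (inord i) ^+ 2.
have yE i : x i ^+ 2 = y i by rewrite /y inord_val.
rewrite (eq_bigr (fun i : 'I_5 => y i)) => [|i _]; last exact: yE.
rewrite [X in 4 * X](eq_bigr (fun i : 'I_5 => y i * y (ordS i))) => [|i _];
  last by rewrite -!yE.
rewrite !big_ord_recl !big_ord0 /= !addr0 !addrA subr_ge0.
by apply: horn_form_copositive; apply: sqr_ge0.
Qed.

Lemma horn_form_homog (R : realType) : horn_form R \is 4.-homog.
Proof.
have X2 i : ('X_i : {mpoly R[5]}) ^+ 2 \is 2.-homog.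
  by apply: (@dhomogMn _ _ _ 1 _ 2); rewrite dhomogX /= mdeg1.
apply: rpredB; last apply: rpredZ.
- by apply: (@dhomogMn _ _ _ 2 _ 2); apply: rpred_sum.
- by apply: rpred_sum => i _; apply: (@dhomogM _ _ _ 2 _ 2).
Qed.

(** The parameter is centred between the two axes, so that the restricted form
    is a monomial, to which [sum_sqr_monomial] applies. *)
Definition edge_line (R : comNzRingType) (j : 'I_5) : 'I_5 -> {poly R} :=
  fun i => if i == j then 1 + 'X else if i == ordS j then 1 - 'X else 0.

(** The factor 2 makes these the points of [edge_line] at [1] and [-1]. *)
Definition axis_point (R : comNzRingType) (j : 'I_5) : 'I_5 -> R :=
  fun i => (i == j)%:R *+ 2.

Lemma horn_form_edge (R : realType) (j : 'I_5) :
  mmap polyC (edge_line R j) (horn_form R) = 16 *: 'X^2.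
Proof.
rewrite mmap_horn_form /edge_line.
case: j => [[|[|[|[|[|//]]]]] jlt];
  rewrite !big_ord_recl !big_ord0 -!val_eqE /= -mul_polyC rmorph_nat; ring.
Qed.

Lemma eq_ordS_ord5 (j : 'I_5) : (j == ordS j) = false.
Proof. by case: j => [[|[|[|[|[|//]]]]] jlt]. Qed.

(** Each [H i] restricts to [c t^k] on the line, an odd function of [t]; the two
    axis points are at [t = 1] and [t = -1]. *)
Lemma sos_odd_pow_axes_opp (R : realType) (k r : nat)
    (H : 'I_r -> {mpoly R[5]}) :
  odd k -> horn_form R ^+ k = \sum_(i < r) H i ^+ 2 ->
  forall i j, (H i).@[axis_point R (ordS j)] = - (H i).@[axis_point R j].
Proof.
move=> oddk FkE i j; pose p i := mmap polyC (edge_line R j) (H i).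
have sump : \sum_(i < r) p i ^+ 2 = (16 ^+ k) *: 'X^(k.*2).
  under eq_bigr do rewrite -rmorphXn.
  rewrite -rmorph_sum -FkE rmorphXn /= horn_form_edge exprZn -exprM.
  by rewrite mul2n.
have pE := sum_sqr_monomial sump i.
have p1 : (H i).@[axis_point R j] = (p i).[1].
  rewrite horner_mmap; apply: meval_eq => l; rewrite /edge_line /axis_point.
  by case: eqP => _; [|case: eqP => _]; rewrite !hornerE ?subrr ?mul0rn.
have pN1 : (H i).@[axis_point R (ordS j)] = (p i).[-1].
  rewrite horner_mmap; apply: meval_eq => l; rewrite /edge_line /axis_point.
  case: (l =P j) => [->|_]; last first.
    by case: eqP => _; rewrite !hornerE ?opprK ?mul0rn.
  by rewrite eq_ordS_ord5 !hornerE subrr mul0rn.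
by rewrite p1 pN1 pE !hornerE expr1n -signr_odd oddk expr1 mulr1 mulrN1.
Qed.

Theorem theorem41 (R : realType) : stubborn 4 (horn_form R).
Proof.
split; [exact: horn_form_homog | exact: horn_form_nonneg |].
move=> k oddk [e [r [H [_ _ FkE]]]].
have H0 i : (H i).@[axis_point R ord0] = 0.
  have alt n : (H i).@[axis_point R (iter n (@ordS 5) ord0)]
      = (-1) ^+ n * (H i).@[axis_point R ord0].
    elim: n => [|n IHn]; first by rewrite mul1r.
    by rewrite iterS (sos_odd_pow_axes_opp oddk FkE) IHn exprS mulN1r mulNr.
  have := alt 5; rewrite (_ : iter 5 _ _ = ord0); last exact: val_inj.
  (* The length 5 of the cycle is odd, so the sign does not cancel. *)
  rewrite -signr_odd mulN1r => /eqP.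
  by rewrite -subr_eq0 opprK -mulr2n mulrn_eq0 => /eqP.
have /eqP: (horn_form R ^+ k).@[axis_point R ord0] = 0.
  by rewrite FkE rmorph_sum big1 // => i _; rewrite rmorphXn /= H0 expr0n.
rewrite rmorphXn /= expf_eq0 => /andP[_].
rewrite /meval mmap_horn_form /axis_point !big_ord_recl !big_ord0 -!val_eqE /=.
by apply/negP; rewrite (_ : _ - _ = 16%:R) ?pnatr_eq0 //; ring.
Qed.
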